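(* Suppose that the algebra $A(\xi)$ is such that $\alpha=1$ and $\beta=\nu=0$. Let $\pi: A(\xi)\to B(\xi)$ be the algebra map sending $y$ to $0$ (and $x\mapsto x$, $h\mapsto h$ for $h\in\Gamma$). Then any irreducible representation of $A(\xi)$ factorizes through $\pi$. In particular, the irreducible representations of $A(\xi)$ are described as follows: for each $\eta\in F(\xi)$ the $B(\xi)$-module $W(\eta)$, regarded as an $A(\xi)$-module via $\pi$, is irreducible; every irreducible $A(\xi)$-module is isomorphic to $W(\eta)$ for some $\eta\in F(\xi)$; and $W(\eta)\simeq W(\eta')$ if and only if $\eta=\eta'\chi_1^m$ for some integer $m$.
   Context: Let $k$ be an algebraically closed field of characteristic $0$, $\Gamma$ a finite abelian group, $\widehat{\Gamma}$ its group of characters $\Gamma\to k^\times$, with trivial character $\epsilon$. Let $g_1,g_2\in\Gamma$ and $\chi_1,\chi_2\in\widehat\Gamma$ with $\chi_1(g_2)\chi_2(g_1)=1$. Let $r>1$ be the order of $q:=\chi_1(g_1)$ and $s>1$ the order of $\chi_2(g_2)$. Let $\alpha_{11},\alpha_{22},\nu\in k$ be scalars such that: $\alpha_{11}=0$ if $g_1^r=1$ or $\chi_1^r\neq\epsilon$; $\alpha_{22}=0$ if $g_2^s=1$ or $\chi_2^s\ne\epsilon$; $\nu=0$ if $g_1g_2=1$ or $\chi_1\chi_2\neq\epsilon$. The lifting $A$ of the quantum plane is the pointed Hopf algebra (of dimension $|\Gamma|rs$) generated by the elements $h\in\Gamma$ (with the relations of the group $\Gamma$) and $x,y$, with relations $hx=\chi_1(h)xh$,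 $hy=\chi_2(h)yh$ ($h\in\Gamma$), $x^r=\alpha_{11}(g_1^r-1)$, $y^s=\alpha_{22}(g_2^s-1)$, $xy=\chi_2(g_1)yx+\nu(g_1g_2-1)$. Let $\Lambda=\{g\in\Gamma:\chi_1(g)=\chi_2(g)=1\}$, a subgroup of $\Gamma$ that is central in $A$. If $\alpha_{11}\ne0$ then $g_1^r\in\Lambda$, and if $\alpha_{22}\neq 0$ then $g_2^s\in\Lambda$. Fix $\xi\in\widehat\Lambda$ and put $\alpha=\alpha_{11}(\xi(g_1^r)-1)$ and $\beta=\alpha_{22}(\xi(g_2^s)-1)$ (understood to be $0$ when $\alpha_{11}=0$, resp. $\alpha_{22}=0$). The algebra $A(\xi)$ is the quotient of $A$ by the relations $g=\xi(g)1$ for $g\in\Lambda$; that is, it is generated by $x$, $y$ and $h\in\Gamma$ with the relations of $\Gamma$ and $g=\xi(g)$ ($g\in\Lambda$), $hx=\chi_1(h)xh$, $hy=\chi_2(h)yh$ ($h\in\Gamma$), $x^r=\alpha$, $y^s=\beta$, $xy=\chi_2(g_1)yx+\nu(g_1g_2-1)$. Let $F(\xi)=\{\eta\in\widehat\Gamma:\eta|_\Lambda=\xi\}$. When $\alpha=1$ (so that $\chi_1^r=\epsilon$ and $\chi_1$ has order $r$), let $B(\xi)$ be the algebra generated by $x$ and $h\in\Gamma$ with the relations of $\Gamma$ and $g=\xi(g)$ ($g\in\Lambda$), $hx=\chi_1(h)xh$ ($h\in\Gamma$), $x^r=1$. For $\eta\in F(\xi)$, $W(\eta)$ is the $B(\xi)$-module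 with basis $f_i$, $i\in\mathbf{Z}/r$, and action $x.f_i=f_{i+1}$, $h.f_i=(\chi_1^i\eta)(h)f_i$ for $h\in\Gamma$ (so $x.f_{r-1}=f_0$). *)

(* Defs.v *)
From HB Require Import structures.
From mathcomp Require Import all_boot all_order all_fingroup all_algebra.
From mathcomp Require Import generic_quotient ring_quotient boolp.
From mathcomp Require Import finmap monalg.

Set Implicit Arguments.
Unset Strict Implicit.
Unset Printing Implicit Defensive.

Import GRing.Theory.
Local Open Scope ring_scope.
Local Open Scope quotient_scope.

(** A presented algebra may collapse to the zero ring, which [algType] excludes.
    A k-algebra is therefore handled here as a [pzRingType] together with a ring
    morphism from k whose image is central. *)

Section FreeAlgebra.
Variables (k : fieldType) (I : choiceType).
Local Notation F := {malg k[{fmonom I}]}.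

Definition free_gen (i : I) : F := << fmu i >>.

(** Two-sided ideal generated by [rel]: finite sums of [u * r * v], [r] in [rel]. *)
Inductive ideal_gen (rel : F -> Prop) : F -> Prop :=
| ideal_gen0 : ideal_gen rel 0
| ideal_genD a u r v :
    ideal_gen rel a -> rel r -> ideal_gen rel (a + u * r * v).

Lemma free_algC_comm (c : k) (a : F) : GRing.comm (c *: 1) a.
Proof.
rewrite /GRing.comm -scalerAl mul1r -mul_malgC.
have -> : c *: 1 = c%:MP :> F by rewrite -mul_malgC mulr1.
rewrite !malgM_def fgmulUg fgmulgU; apply: eq_bigr => m _.
by rewrite mul1m mulm1 mulrC.
Qed.

Section Eval.
Variables (S : pzRingType) (iota : {rmorphism k -> S}) (v : I -> S).

Definition free_eval (g : F) : S :=
  \sum_(m <- msupp g) iota g@_m * \prod_(i <- (m : seq I)) v i.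

Lemma free_evalEw (d : {fset {fmonom I}}) g : (msupp g `<=` d)%fset ->
  free_eval g = \sum_(m <- d) iota g@_m * \prod_(i <- (m : seq I)) v i.
Proof.
move=> le; rewrite /free_eval (big_fset_incl _ le) //= => m _ /mcoeff_outdom ->.
by rewrite rmorph0 mul0r.
Qed.

Lemma free_evalU c (m : {fmonom I}) :
  free_eval << c *g m >> = iota c * \prod_(i <- (m : seq I)) v i.
Proof. by rewrite (free_evalEw msuppU_le) big_seq_fset1 mcoeffUU. Qed.

Lemma free_eval_zmod : zmod_morphism free_eval.
Proof.
move=> a b; pose E := (msupp a `|` msupp b)%fset.
have leE : (msupp (a - b) `<=` E)%fset by exact: msuppB_le.
rewrite (free_evalEw leE) (free_evalEw (fsubsetUl _ _ : (msupp a `<=` E)%fset)).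
rewrite (free_evalEw (fsubsetUr _ _ : (msupp b `<=` E)%fset)) -sumrB.
by apply: eq_bigr => m _; rewrite mcoeffB rmorphB mulrBl.
Qed.

HB.instance Definition _ :=
  GRing.isZmodMorphism.Build F S free_eval free_eval_zmod.

Lemma free_eval_gen i : free_eval (free_gen i) = v i.
Proof. by rewrite free_evalU rmorph1 mul1r fmU big_seq1. Qed.

Lemma free_eval1 : free_eval 1 = 1.
Proof. by rewrite free_evalU rmorph1 mul1r fm1 big_nil. Qed.

Lemma free_evalZ c a : free_eval (c *: a) = iota c * free_eval a.
Proof.
rewrite (free_evalEw (msuppZ_le c a)) /free_eval mulr_sumr.
by apply: eq_bigr => m _; rewrite mcoeffZ rmorphM mulrA.
Qed.

Hypothesis iota_central : forall c s, GRing.comm (iota c) s.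

Lemma free_evalM : {morph free_eval : a b / a * b}.
Proof.
move=> a b; rewrite malgME raddf_sum /= [X in _ = X * _]/free_eval mulr_suml.
apply: eq_bigr => m _; rewrite raddf_sum /= [X in _ = _ * X]/free_eval mulr_sumr.
apply: eq_bigr => n _.
rewrite free_evalU fmM big_cat rmorphM -!mulrA; congr (_ * _).
by rewrite !mulrA; congr (_ * _); exact: iota_central.
Qed.

Lemma free_evalX n : {morph free_eval : a / a ^+ n}.
Proof.
move=> a; elim: n => [|n IH]; first by rewrite !expr0 free_eval1.
by rewrite !exprS free_evalM IH.
Qed.

End Eval.
End FreeAlgebra.

Section PresentedAlgebra.
Variables (k : fieldType) (I : choiceType) (rel : {malg k[{fmonom I}]} -> Prop).
Local Notation F := {malg k[{fmonom I}]}.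

Definition relator_ideal : {pred F} := fun a => `[< ideal_gen rel a >].

Lemma relator_idealP a : reflect (ideal_gen rel a) (a \in relator_ideal).
Proof. exact: asboolP. Qed.

Lemma ideal_gen_add a b :
  ideal_gen rel a -> ideal_gen rel b -> ideal_gen rel (a + b).
Proof.
move=> Ia; elim=> [|c u r v _ IH rr]; first by rewrite addr0.
by rewrite addrA; constructor.
Qed.

Lemma ideal_gen_mul u v a : ideal_gen rel a -> ideal_gen rel (u * a * v).
Proof.
elim=> [|b u' r v' _ IH rr]; first by rewrite mulr0 mul0r; constructor.
by rewrite mulrDr mulrDl !mulrA -(mulrA _ v'); constructor.
Qed.

Lemma relator_ideal_zmod : zmod_closed relator_ideal.
Proof.
split=> [|a b /relator_idealP Ia /relator_idealP Ib]; apply/relator_idealP.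
  by constructor.
apply: ideal_gen_add => //.
by have := ideal_gen_mul (-1) 1 Ib; rewrite mulN1r mulr1.
Qed.

HB.instance Definition _ :=
  GRing.isZmodClosed.Build F relator_ideal relator_ideal_zmod.

Definition palg : Type := Quotient.quot (relator_ideal : zmodClosed F).

HB.instance Definition _ := GRing.Zmodule.on palg.
HB.instance Definition _ := EqQuotient.on palg.

Definition palg_one : palg := \pi_palg 1.
Definition palg_mul : palg -> palg -> palg := lift_op2 palg *%R.

Lemma palg_eqP (a b : F) : reflect (\pi_palg a = \pi b) (a - b \in relator_ideal).
Proof. by rewrite Quotient.idealrBE; exact: eqP. Qed.

Lemma pi_palg_mul : {morph \pi_palg : a b / a * b >-> palg_mul a b}.
Proof.
move=> a b; unlock palg_mul; apply/palg_eqP/relator_idealP.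
set a' := repr _; set b' := repr _.
have /palg_eqP/relator_idealP Ia : \pi_palg a = \pi a' by rewrite reprK.
have /palg_eqP/relator_idealP Ib : \pi_palg b = \pi b' by rewrite reprK.
have -> : a * b - a' * b' = 1 * (a - a') * b + a' * (b - b') * 1.
  by rewrite mul1r mulr1 mulrBl mulrBr addrA subrK.
by apply: ideal_gen_add; apply: ideal_gen_mul.
Qed.

Lemma palg_mulA : associative palg_mul.
Proof.
by move=> a b c; rewrite -[a]reprK -[b]reprK -[c]reprK -!pi_palg_mul mulrA.
Qed.

Lemma palg_mul1 : left_id palg_one palg_mul.
Proof. by move=> a; rewrite -[a]reprK -pi_palg_mul mul1r. Qed.

Lemma palg_mulr1 : right_id palg_one palg_mul.
Proof. by move=> a; rewrite -[a]reprK -pi_palg_mul mulr1. Qed.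

Lemma pi_palgD : {morph \pi_palg : a b / a + b}.
Proof. exact: Quotient.pi_add. Qed.

Lemma palg_mulDl : left_distributive palg_mul +%R.
Proof.
move=> a b c; rewrite -[a]reprK -[b]reprK -[c]reprK.
by rewrite -!pi_palgD -!pi_palg_mul -pi_palgD mulrDl.
Qed.

Lemma palg_mulDr : right_distributive palg_mul +%R.
Proof.
move=> a b c; rewrite -[a]reprK -[b]reprK -[c]reprK.
by rewrite -!pi_palgD -!pi_palg_mul -pi_palgD mulrDr.
Qed.

HB.instance Definition _ := GRing.Zmodule_isPzRing.Build palg
  palg_mulA palg_mul1 palg_mulr1 palg_mulDl palg_mulDr.

Definition palg_pi (a : F) : palg := \pi a.

Lemma palg_pi_zmod : zmod_morphism palg_pi.
Proof. by move=> a b; rewrite /palg_pi pi_palgD Quotient.pi_opp. Qed.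

Lemma palg_pi_monoid : monoid_morphism palg_pi.
Proof. by split=> // a b; exact: pi_palg_mul. Qed.

HB.instance Definition _ := GRing.isZmodMorphism.Build F palg palg_pi palg_pi_zmod.
HB.instance Definition _ := GRing.isMonoidMorphism.Build F palg palg_pi palg_pi_monoid.

Lemma palg_piP (a : palg) : exists b, a = palg_pi b.
Proof. by exists (repr a); rewrite /palg_pi reprK. Qed.

Lemma palg_rel (a : F) : rel a -> palg_pi a = 0.
Proof.
move=> ra; rewrite -(rmorph0 palg_pi); apply/palg_eqP/relator_idealP.
by rewrite subr0 -[a]mulr1 -[a]mul1r -[_ * 1]add0r; do !constructor.
Qed.

Definition palg_gen (i : I) : palg := palg_pi (free_gen k i).

Definition palg_in (c : k) : palg := palg_pi (c *: 1).

Lemma palg_in_zmod : zmod_morphism palg_in.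
Proof. by move=> c d; rewrite /palg_in scalerBl rmorphB. Qed.

Lemma palg_in_monoid : monoid_morphism palg_in.
Proof.
split=> [|c d]; first by rewrite /palg_in scale1r rmorph1.
by rewrite /palg_in -rmorphM mulr_algl scalerA.
Qed.

HB.instance Definition _ := GRing.isZmodMorphism.Build k palg palg_in palg_in_zmod.
HB.instance Definition _ := GRing.isMonoidMorphism.Build k palg palg_in palg_in_monoid.

Lemma palg_piZ c a : palg_pi (c *: a) = palg_in c * palg_pi a.
Proof. by rewrite /palg_in -rmorphM mulr_algl. Qed.

Lemma palg_in_central (c : k) (a : palg) : GRing.comm (palg_in c) a.
Proof.
have [b ->] := palg_piP a.
by rewrite /GRing.comm /palg_in -!rmorphM; congr palg_pi; exact: free_algC_comm.
Qed.

Section Lift.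
Variables (S : pzRingType) (iota : {rmorphism k -> S}).
Hypothesis iota_central : forall c s, GRing.comm (iota c) s.
Variable v : I -> S.
Hypothesis v_rel : forall a, rel a -> free_eval iota v a = 0.

Definition palg_lift of (forall c s, GRing.comm (iota c) s)
    & (forall a, rel a -> free_eval iota v a = 0) : palg -> S :=
  fun a => free_eval iota v (repr a).

Local Notation lift := (palg_lift iota_central v_rel).

Lemma palg_lift_pi a : lift (palg_pi a) = free_eval iota v a.
Proof.
apply/eqP; rewrite -subr_eq0 -raddfB /=; apply/eqP.
have /palg_eqP/relator_idealP : \pi_palg (repr (palg_pi a)) = \pi a.
  by rewrite reprK.
elim=> [|b x r y _ IH rr]; first exact: raddf0.
rewrite raddfD /= IH add0r !(free_evalM _ iota_central).
by rewrite (v_rel rr) mulr0 mul0r.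
Qed.

Lemma palg_lift_zmod : zmod_morphism lift.
Proof.
move=> a b; have [a' ->] := palg_piP a; have [b' ->] := palg_piP b.
by rewrite -rmorphB !palg_lift_pi raddfB.
Qed.

Lemma palg_lift_monoid : monoid_morphism lift.
Proof.
split=> [|a b]; first by rewrite -(rmorph1 palg_pi) palg_lift_pi free_eval1.
have [a' ->] := palg_piP a; have [b' ->] := palg_piP b.
by rewrite -rmorphM !palg_lift_pi (free_evalM _ iota_central).
Qed.

HB.instance Definition _ := GRing.isZmodMorphism.Build palg S lift palg_lift_zmod.
HB.instance Definition _ := GRing.isMonoidMorphism.Build palg S lift palg_lift_monoid.

Lemma palg_lift_gen i : lift (palg_gen i) = v i.
Proof. by rewrite palg_lift_pi free_eval_gen. Qed.

Lemma palg_lift_in c : lift (palg_in c) = iota c.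
Proof. by rewrite palg_lift_pi free_evalZ free_eval1 mulr1. Qed.

End Lift.

End PresentedAlgebra.

Definition irreducible (R : pzRingType) (V : lmodType R) : Prop :=
  (exists v : V, v != 0) /\
  forall S : {pred V}, submod_closed S ->
    (forall v, v \in S -> v = 0) \/ (forall v, v \in S).

Definition isomorphic (R : pzRingType) (V W : lmodType R) : Prop :=
  exists f : {linear V -> W}, bijective f.

(** [act : R -> V -> V] is a ring morphism R -> End(V). *)
Definition is_representation (R : pzRingType) (V : zmodType)
    (act : R -> V -> V) : Prop :=
  [/\ forall a, {morph act a : v w / v + w},
      forall a b v, act (a + b) v = act a v + act b v,
      forall a b v, act (a * b) v = act a (act b v)
    & forall v, act 1 v = v].

Definition factors_through (A B : pzRingType) (f : {rmorphism A -> B})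
    (V : lmodType A) : Prop :=
  exists2 act : B -> V -> V, is_representation act &
    forall a v, a *: v = act (f a) v.

Definition pullback (A B : pzRingType) (f : {rmorphism A -> B})
  (V : lmodType B) : Type := V.

Section Pullback.
Variables (A B : pzRingType) (f : {rmorphism A -> B}) (V : lmodType B).
Local Notation pb := (pullback f V).

HB.instance Definition _ := GRing.Zmodule.on pb.

Definition pullback_scale (a : A) (v : pb) : pb := f a *: (v : V).

Lemma pullback_scaleA a b v :
  pullback_scale a (pullback_scale b v) = pullback_scale (a * b) v.
Proof. by rewrite /pullback_scale scalerA rmorphM. Qed.

Lemma pullback_scale1 : left_id 1 pullback_scale.
Proof. by move=> v; rewrite /pullback_scale rmorph1 scale1r. Qed.

Lemma pullback_scaleDr : right_distributive pullback_scale +%R.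
Proof. by move=> a v w; rewrite /pullback_scale scalerDr. Qed.

Lemma pullback_scaleDl v : {morph pullback_scale^~ v : a b / a + b}.
Proof. by move=> a b; rewrite /pullback_scale rmorphD scalerDl. Qed.

HB.instance Definition _ := GRing.Zmodule_isLmodule.Build A pb
  pullback_scaleA pullback_scale1 pullback_scaleDr pullback_scaleDl.

End Pullback.

Definition mxmodule (k : fieldType) (n : nat) (A : pzRingType)
  (rho : {rmorphism A -> 'M[k]_n}) : Type := 'cV[k]_n.

Section MatrixModule.
Variables (k : fieldType) (n : nat) (A : pzRingType).
Variable (rho : {rmorphism A -> 'M[k]_n}).
Local Notation M := (mxmodule rho).

HB.instance Definition _ := GRing.Zmodule.on M.

Definition mxmodule_scale (a : A) (v : M) : M := rho a *m (v : 'cV_n).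

Lemma mxmodule_scaleA a b v :
  mxmodule_scale a (mxmodule_scale b v) = mxmodule_scale (a * b) v.
Proof. by rewrite /mxmodule_scale mulmxA rmorphM. Qed.

Lemma mxmodule_scale1 : left_id 1 mxmodule_scale.
Proof. by move=> v; rewrite /mxmodule_scale rmorph1 mul1mx. Qed.

Lemma mxmodule_scaleDr : right_distributive mxmodule_scale +%R.
Proof. by move=> a v w; rewrite /mxmodule_scale mulmxDr. Qed.

Lemma mxmodule_scaleDl v : {morph mxmodule_scale^~ v : a b / a + b}.
Proof. by move=> a b; rewrite /mxmodule_scale rmorphD mulmxDl. Qed.

HB.instance Definition _ := GRing.Zmodule_isLmodule.Build A M
  mxmodule_scaleA mxmodule_scale1 mxmodule_scaleDr mxmodule_scaleDl.

End MatrixModule.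

(** A character of [H] is a function on the ambient group; only its values on
    [H] matter, so characters are compared pointwise on [H]. *)
Record character (k : fieldType) (gT : finGroupType) (H : {set gT}) := Character {
  char_fun :> gT -> k;
  char1 : char_fun 1%g = 1;
  charM : {in H &, {morph char_fun : g h / (g * h)%g >-> g * h}}
}.

Record plane_datum (k : fieldType) (gT : finGroupType) := PlaneDatum {
  g1 : gT;
  g2 : gT;
  chi1 : character k [set: gT];
  chi2 : character k [set: gT];
  chi12 : chi1 g2 * chi2 g1 = 1;
  r : nat;
  r_gt1 : (1 < r)%N;
  r_order : r.-primitive_root (chi1 g1);
  s : nat;
  s_gt1 : (1 < s)%N;
  s_order : s.-primitive_root (chi2 g2);
  alpha11 : k;
  alpha22 : k;
  nu : k;
  alpha11_eq0 :
    (g1 ^+ r = 1)%g \/ ~ (forall h, chi1 h ^+ r = 1) -> alpha11 = 0;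
  alpha22_eq0 :
    (g2 ^+ s = 1)%g \/ ~ (forall h, chi2 h ^+ s = 1) -> alpha22 = 0;
  nu_eq0 :
    (g1 * g2 = 1)%g \/ ~ (forall h, chi1 h * chi2 h = 1) -> nu = 0
}.

Variant genA (gT : Type) := Ax | Ay | Ah of gT.
Variant genB (gT : Type) := Bx | Bh of gT.
Arguments Ax {gT}.
Arguments Ay {gT}.
Arguments Bx {gT}.

Section GeneratorsChoice.
Variable gT : choiceType.

Definition genA_code (a : genA gT) : option (option gT) :=
  match a with Ax => None | Ay => Some None | Ah h => Some (Some h) end.
Definition genA_decode (o : option (option gT)) : genA gT :=
  match o with None => Ax | Some None => Ay | Some (Some h) => Ah h end.
Lemma genA_codeK : cancel genA_code genA_decode. Proof. by case. Qed.
HB.instance Definition _ := Choice.copy (genA gT) (can_type genA_codeK).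

Definition genB_code (a : genB gT) : option gT :=
  match a with Bx => None | Bh h => Some h end.
Definition genB_decode (o : option gT) : genB gT :=
  match o with None => Bx | Some h => Bh h end.
Lemma genB_codeK : cancel genB_code genB_decode. Proof. by case. Qed.
HB.instance Definition _ := Choice.copy (genB gT) (can_type genB_codeK).
End GeneratorsChoice.

Section QuantumPlane.
Variables (k : fieldType) (gT : finGroupType) (D : plane_datum k gT).

Definition Lambda : {set gT} := [set g | (chi1 D g == 1) && (chi2 D g == 1)].

Variable xi : character k Lambda.

(** Where g1^r lies outside [Lambda] the factor [alpha11] vanishes, so the
    value of [xi] there is irrelevant; similarly for [beta]. *)
Definition alpha : k := alpha11 D * (xi (g1 D ^+ r D)%g - 1).
Definition beta : k := alpha22 D * (xi (g2 D ^+ s D)%g - 1).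

Section RelationsA.
Let x := free_gen k (Ax : genA gT).
Let y := free_gen k (Ay : genA gT).
Let gr (h : gT) := free_gen k (Ah h).

Inductive relA : {malg k[{fmonom (genA gT)}]} -> Prop :=
| relA_1 : relA (gr 1%g - 1)
| relA_M g h : relA (gr (g * h)%g - gr g * gr h)
| relA_Lambda g : g \in Lambda -> relA (gr g - xi g *: 1)
| relA_hx h : relA (gr h * x - chi1 D h *: (x * gr h))
| relA_hy h : relA (gr h * y - chi2 D h *: (y * gr h))
| relA_xr : relA (x ^+ r D - alpha *: 1)
| relA_ys : relA (y ^+ s D - beta *: 1)
| relA_xy : relA (x * y - (chi2 D (g1 D) *: (y * x)
                           + nu D *: (gr (g1 D * g2 D)%g - 1))).
End RelationsA.

Section RelationsB.
Let x := free_gen k (Bx : genB gT).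
Let gr (h : gT) := free_gen k (Bh h).

Inductive relB : {malg k[{fmonom (genB gT)}]} -> Prop :=
| relB_1 : relB (gr 1%g - 1)
| relB_M g h : relB (gr (g * h)%g - gr g * gr h)
| relB_Lambda g : g \in Lambda -> relB (gr g - xi g *: 1)
| relB_hx h : relB (gr h * x - chi1 D h *: (x * gr h))
| relB_xr : relB (x ^+ r D - 1).
End RelationsB.

Definition algA : pzRingType := palg relA.
Definition algB : pzRingType := palg relB.

(** F(xi): the characters of the whole group extending [xi]. *)
Record extension := Extension {
  ext_char :> character k [set: gT];
  ext_res : {in Lambda, ext_char =1 xi}
}.

Section Projection.
Hypotheses (alpha_1 : alpha = 1) (beta_0 : beta = 0) (nu_0 : nu D = 0).

Definition proj_gen (a : genA gT) : algB :=
  match a with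
  | Ax => palg_gen relB Bx
  | Ay => 0
  | Ah h => palg_gen relB (Bh h)
  end.

Lemma proj_rel a : relA a -> free_eval (palg_in relB) proj_gen a = 0.
Proof.
have C := @palg_in_central k _ relB.
have M := free_evalM proj_gen C; have X := free_evalX proj_gen C.
have E := (M, X, @free_evalZ, @free_eval_gen, @free_eval1).
have relP : forall b, relB b -> palg_pi relB b = 0 by exact: palg_rel.
case=> [|g h|g Lg|h|h|||]; rewrite !(raddfB, raddfD) /= !E /=.
- by rewrite -(rmorph1 (palg_pi relB)) -rmorphB; apply/relP/relB_1.
- by rewrite -rmorphM -rmorphB; apply/relP/relB_M.
- rewrite -(rmorph1 (palg_pi relB)) -palg_piZ -rmorphB.
  exact/relP/relB_Lambda.
- by rewrite -!rmorphM -palg_piZ -rmorphB; apply/relP/relB_hx.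
- by rewrite !(mulr0, mul0r) subr0.
- rewrite alpha_1 rmorph1 mulr1 -(rmorph1 (palg_pi relB)) -rmorphXn -rmorphB.
  exact/relP/relB_xr.
- by rewrite beta_0 rmorph0 mul0r subr0 expr0n; case: (s D) (s_gt1 D).
- by rewrite nu_0 rmorph0 !(mulr0, mul0r, subr0, oppr0, addr0).
Qed.

Definition proj : {rmorphism algA -> algB} :=
  palg_lift (@palg_in_central k _ relB) proj_rel.

Lemma projE a : proj (palg_gen relA a) = proj_gen a.
Proof. exact: palg_lift_gen. Qed.

Lemma proj_in c : proj (palg_in relA c) = palg_in relB c.
Proof. exact: palg_lift_in. Qed.

End Projection.

Section ModuleW.
Hypothesis alpha_1 : alpha = 1.
Variable eta : extension.

Definition W_gen (b : genB gT) : 'M[k]_(r D) :=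
  match b with
  | Bx => \matrix_(i, j) (i == ordS j)%:R
  | Bh h => diag_mx (\row_i (chi1 D h ^+ i * eta h))
  end.

Lemma chi1_expr h : chi1 D h ^+ r D = 1.
Proof.
have [//|/eqP ne] := eqVneq (chi1 D h ^+ r D) 1.
have a0 : alpha11 D = 0 by apply: alpha11_eq0; right=> /(_ h).
by have := oner_neq0 k; rewrite -alpha_1 /alpha a0 mul0r eqxx.
Qed.

Lemma W_genX n (i j : 'I_(r D)) :
  (W_gen Bx ^+ n) i j = ((i : nat) == (j + n) %% r D)%N%:R.
Proof.
elim: n i j => [|n IH] i j.
  by rewrite expr0 mxE addn0 modn_small // -val_eqE.
rewrite exprSr mxE (bigD1 (ordS j)) //= mxE eqxx mulr1 big1 ?addr0.
  by rewrite IH /= modnDml addSnnS.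
by move=> l /negPf nl; rewrite mxE nl mulr0.
Qed.

Lemma scalar_mx_central (c : k) (M : 'M[k]_(r D)) : GRing.comm (scalar_mx c) M.
Proof. exact: (esym (scalar_mxC c M)). Qed.

Lemma W_rel b : relB b -> free_eval (@scalar_mx k (r D)) W_gen b = 0.
Proof.
have C := scalar_mx_central.
have M := free_evalM W_gen C; have X := free_evalX W_gen C.
have E := (M, X, @free_evalZ, @free_eval_gen, @free_eval1).
case=> [|g h|g Lg|h|]; rewrite raddfB /= !E;
  try (apply/eqP; rewrite subr_eq0; apply/eqP).
- by apply/matrixP=> i j; rewrite !mxE !char1 expr1n mul1r.
- rewrite [RHS]mulmx_diag; congr diag_mx; apply/rowP=> i; rewrite !mxE.
  by rewrite !charM ?inE // exprMn mulrACA.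
- rewrite mulr1; apply/matrixP=> i j; rewrite !mxE (ext_res _ Lg).
  by move: Lg; rewrite inE => /andP[/eqP-> _]; rewrite expr1n mul1r.
- rewrite [LHS]mul_diag_mx [RHS]mul_scalar_mx [W_gen Bx * _]mul_mx_diag.
  apply/matrixP=> i j; rewrite !mxE.
  case: eqP => [->|_]; last by rewrite !(mulr0, mul0r).
  by rewrite mulr1 mul1r /= expr_mod ?chi1_expr // exprS mulrA.
- apply/matrixP=> i j; rewrite W_genX !mxE -val_eqE /=.
  by rewrite modnDr modn_small.
Qed.

(** W(eta), with f_i the i-th basis column vector; see [W_x] and [W_h]. *)
Definition W_rep : {rmorphism algB -> 'M[k]_(r D)} :=
  palg_lift scalar_mx_central W_rel.

Lemma W_repE b : W_rep (palg_gen relB b) = W_gen b.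
Proof. exact: palg_lift_gen. Qed.

Definition W : lmodType algB := mxmodule W_rep.

Definition W_basis (i : 'I_(r D)) : W := (delta_mx i 0 : 'cV[k]_(r D)).

Lemma W_x i : (palg_gen relB Bx : algB) *: W_basis i = W_basis (ordS i).
Proof.
have -> : palg_gen relB Bx *: W_basis i =
    W_gen Bx *m (delta_mx i 0 : 'cV_(r D)) :> 'cV_(r D) by rewrite -W_repE.
by rewrite -colE; apply/colP=> j; rewrite !mxE eqxx andbT.
Qed.

Lemma W_h h i : (palg_gen relB (Bh h) : algB) *: W_basis i =
  (palg_in relB (chi1 D h ^+ i * eta h) : algB) *: W_basis i.
Proof.
have -> : palg_gen relB (Bh h) *: W_basis i =
    W_gen (Bh h) *m (delta_mx i 0 : 'cV_(r D)) :> 'cV_(r D) by rewrite -W_repE.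
have -> c : palg_in relB c *: W_basis i =
    c *: (delta_mx i 0 : 'cV_(r D)) :> 'cV_(r D).
  rewrite -mul_scalar_mx; congr (_ *m _); exact: palg_lift_in.
rewrite mul_diag_mx; apply/colP=> j; rewrite !mxE.
by case: eqP => [->|]; rewrite ?andFb ?mulr0.
Qed.

End ModuleW.

End QuantumPlane.

(* Main.v *)
From HB Require Import structures.
Require Import Defs.
From mathcomp Require Import all_boot all_order all_fingroup all_algebra.
From mathcomp Require Import cyclic boolp finmap monalg.

(** The element [y] is normal and nilpotent, so on an irreducible module its
    kernel is a nonzero submodule and [y] acts by zero; the remaining generators
    satisfy the relations of [B(xi)], which gives a section of the projection.
    As [k] is algebraically closed and [Gamma] is finite abelian, an irreducible
    module contains a vector [v] of some weight [eta], and [f_i |-> x^i v] is a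
    nonzero map from [W(eta)], an isomorphism by Schur's lemma since [W(eta)] is
    irreducible: [g_1] separates its basis vectors and [x] permutes them
    cyclically. The weights of [W(eta)] are the [eta chi_1^i], so
    [W(eta)] and [W(eta')] are isomorphic exactly when [eta] is one of the [eta' chi_1^i]. *)

Set Implicit Arguments.
Unset Strict Implicit.
Unset Printing Implicit Defensive.

Import GRing.Theory.
Local Open Scope ring_scope.

(** * Schur's lemma over an arbitrary ring *)

Section Irreducible.
Variable R : pzRingType.
Implicit Types V W : lmodType R.

Lemma isomorphic_sym V W : isomorphic V W -> isomorphic W V.
Proof.
case=> f [g fK gK].
have lin_g := can2_linear fK gK.
pose gL : {linear W -> V} :=
  HB.pack g (GRing.isLinear.Build R W V *:%R g lin_g).
by exists gL; exists f.
Qed.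

(** Kernel and image are submodules, and a single nonzero value excludes the full kernel and the
    zero image. The inverse is chosen from surjectivity. *)
Lemma schur V W (f : {linear V -> W}) :
  irreducible V -> irreducible W -> (exists v, f v != 0) -> bijective f.
Proof.
move=> [_ irrV] [_ irrW] [v fv_neq0].
have f_inj : injective f.
  have [|kerf0|kerfT] := irrV [pred u | f u == 0].
  - split=> [|a u u']; rewrite !inE ?raddf0 // => /eqP fu /eqP fu'.
    by rewrite linearP fu fu' scaler0 addr0.
  - move=> u u' /eqP; rewrite -subr_eq0 -raddfB => fu.
    by apply/eqP; rewrite -subr_eq0; apply/eqP/kerf0.
  - by have := kerfT v; rewrite inE (negPf fv_neq0).
have [|g gK] := @choice W V (fun w u => f u = w); last first.
  by exists g => // u; apply: f_inj; rewrite gK.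
have [|imf0|imfT] := irrW (fun w => `[< exists u, f u = w >]).
- split=> [|a w w' /asboolP[u <-] /asboolP[u' <-]]; apply/asboolP.
    by exists 0; rewrite raddf0.
  by exists (a *: u + u'); rewrite linearP.
- by case/eqP: fv_neq0; apply/imf0/asboolP; exists v.
- by move=> w; apply/asboolP/imfT.
Qed.

End Irreducible.

(** * Structural induction in a presented algebra *)

Section PresentedAlgebraInduction.
Variables (k : fieldType) (I : choiceType) (rel : {malg k[{fmonom I}]} -> Prop).
Local Notation P := (palg rel).

(** Every element lifts to a finite combination of words in the generators; each word is treated by
    induction on its length. *)
Lemma palg_ind (Q : P -> Prop) :
    (forall c, Q (palg_in rel c)) -> (forall i, Q (palg_gen rel i)) ->
    (forall a b, Q a -> Q b -> Q (a + b)) ->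
    (forall a b, Q a -> Q b -> Q (a * b)) ->
  forall a, Q a.
Proof.
move=> Qc Qg QD QM a; have [{}a ->] := palg_piP a.
have Q0 : Q 0 by rewrite -(rmorph0 (palg_in rel)); apply: Qc.
rewrite [a]monalgE raddf_sum; apply: (big_ind Q) => // m _.
have -> : << a@_m *g m >> = a@_m *: << m >> :> {malg k[{fmonom I}]}.
  by apply/malgP=> j; rewrite mcoeffZ !mcoeffU mulrnAr mulr1.
rewrite /= palg_piZ; apply: (QM) => [|{a}]; first exact: Qc.
case: m => m; elim: m => [|i m IHm].
  have -> : << (FMonom [::] : {fmonom I}) >> = 1 :> {malg k[{fmonom I}]}.
    by congr << _ >>; apply/val_inj; rewrite /= fm1.
  by rewrite rmorph1 -(rmorph1 (palg_in rel)); apply: Qc.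
have -> : << (FMonom (i :: m) : {fmonom I}) >> =
    free_gen k i * << (FMonom m : {fmonom I}) >> :> {malg k[{fmonom I}]}.
  rewrite malgM_def fgmulUU mulr1; congr << _ >>.
  by apply/val_inj; rewrite /= fmM fmU.
by rewrite rmorphM; apply: QM => //; apply: Qg.
Qed.

End PresentedAlgebraInduction.

(** * Central scalars, polynomial evaluation and eigenvectors *)

Section CentralScalars.
Variables (k : fieldType) (A : pzRingType) (iota : {rmorphism k -> A}).
Hypothesis iota_central : forall c a, GRing.comm (iota c) a.

Lemma scalar_eq0 (V : lmodType A) c (v : V) :
  v != 0 -> iota c *: v = 0 -> c = 0.
Proof.
move=> v_neq0 cv; apply/eqP; apply: contraNT v_neq0 => c_neq0; apply/eqP.
rewrite -[v]scale1r -(rmorph1 iota) -(mulVf c_neq0) rmorphM -scalerA cv.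
by rewrite scaler0.
Qed.

Lemma scalar_inj (V : lmodType A) c d (v : V) :
  v != 0 -> iota c *: v = iota d *: v -> c = d.
Proof.
move=> v_neq0 /eqP; rewrite -subr_eq0 -scalerBl -rmorphB => /eqP.
by move/(scalar_eq0 v_neq0)/eqP; rewrite subr_eq0 => /eqP.
Qed.

Section PolynomialEvaluation.
Variable T : A.
(* [horner_morph] would require [A] to be a nontrivial ring. *)
Let ev (p : {poly k}) : A := \sum_(i < size p) iota p`_i * T ^+ i.

Let evEw n (p : {poly k}) : (size p <= n)%N ->
  ev p = \sum_(i < n) iota p`_i * T ^+ i.
Proof.
move=> le_pn; rewrite /ev (big_ord_widen _ (fun i => iota p`_i * T ^+ i) le_pn).
rewrite big_mkcond; apply: eq_bigr => i _; case: ltnP => // le_pi.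
by rewrite nth_default // rmorph0 mul0r.
Qed.

Let ev_MXsubC p z : ev (p * ('X - z%:P)) = ev p * (T - iota z).
Proof.
rewrite (@evEw (size p).+1); last first.
  by apply: leq_trans (size_polyMleq _ _) _; rewrite size_XsubC addn2.
under eq_bigr => i _ do
  rewrite mulrBr coefB coefMX coefMC rmorphB mulrBl.
rewrite sumrB mulrBr; congr (_ - _).
  rewrite big_ord_recl /= rmorph0 mul0r add0r mulr_suml.
  by apply: eq_bigr => i _; rewrite exprSr mulrA.
rewrite (evEw (leqnSn _)) mulr_suml; apply: eq_bigr => i _.
by rewrite rmorphM -!mulrA; congr (_ * _); apply: iota_central.
Qed.

(** Evaluation at [T] transports the factorization to [A], one linear factor at a time, because the
    scalars are central. *)
Lemma prod_subC_roots (n : nat) (rs : seq k) : (0 < n)%N ->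
    'X^n - 1 = \prod_(z <- rs) ('X - z%:P) ->
  T ^+ n - 1 = \prod_(z <- rs) (T - iota z).
Proof.
move=> n_gt0 Xn1.
have ev_prod : ev (\prod_(z <- rs) ('X - z%:P)) =
    \prod_(z <- rs) (T - iota z).
  elim/last_ind: rs {Xn1} => [|rs z IHrs].
    by rewrite !big_nil /ev size_poly1 big_ord1 coef1 rmorph1 mulr1.
  by rewrite !big_rcons /= ev_MXsubC IHrs.
rewrite -ev_prod -Xn1 (@evEw n.+1); last by rewrite size_XnsubC.
(* Only the constant and the leading coefficient are nonzero. *)
case: n n_gt0 {Xn1} => // n _; rewrite big_ord_recl big_ord_recr /=.
rewrite big1 => [|i _]; last first.
  rewrite coefB coefXn coef1 /= eqSS ltn_eqF ?lift0 //= subr0.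
  by rewrite rmorph0 mul0r.
rewrite /bump add1n !coefB !coefXn !coef1 /= eqxx sub0r subr0 add0r.
by rewrite rmorphN !rmorph1 mul1r expr0 mulr1 addrC.
Qed.

(** The factors [T - iota z] are applied to [v] one by one; the last nonzero vector before the
    product vanishes is an eigenvector. Every factor preserves [Q], so eigenvectors common to
    several commuting elements can be found in turn. *)
Lemma eigenvector_in (V : lmodType A) (n : nat) (rs : seq k) (Q : V -> Prop) v :
    (0 < n)%N -> 'X^n - 1 = \prod_(z <- rs) ('X - z%:P) ->
    T ^+ n = 1 -> (forall z u, Q u -> Q ((T - iota z) *: u)) ->
    Q v -> v != 0 ->
  exists2 u, Q u /\ u != 0 & exists z, T *: u = iota z *: u.
Proof.
move=> n_gt0 /(prod_subC_roots n_gt0) Tn1 T1 QT Qv v_neq0.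
have {Tn1 T1} : \prod_(z <- rs) (T - iota z) *: v = 0.
  by rewrite -Tn1 T1 subrr scale0r.
elim/last_ind: rs v Qv v_neq0 => [|rs z IHrs] v Qv v_neq0.
  by rewrite big_nil scale1r => v0; rewrite v0 eqxx in v_neq0.
rewrite big_rcons /= -scalerA.
have [/eqP Tv0 _|Tv_neq0] := eqVneq ((T - iota z) *: v) 0.
  by exists v => //; exists z; apply/eqP; rewrite -subr_eq0 -scalerBl.
by apply: IHrs => //; apply: QT.
Qed.

End PolynomialEvaluation.
End CentralScalars.

Lemma char_neq0 (k : fieldType) (gT : finGroupType)
  (chi : character k [set: gT]) h : chi h != 0.
Proof.
apply/eqP => chi0; have := oner_neq0 k.
by rewrite -(Defs.char1 chi) -(mulgV h) Defs.charM ?inE // chi0 mul0r eqxx.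
Qed.

(* The relations of [algA xi] when [alpha xi = 1], [beta xi = 0] and
   [nu D = 0], over an abstract ring: computing in [palg] itself makes the
   unifier unfold the quotient construction. *)
Record degenerate_plane (k : fieldType) (gT : finGroupType)
    (D : plane_datum k gT) (xi : character k (Lambda D)) (A : pzRingType) :=
  DegeneratePlane {
  scal : {rmorphism k -> A};
  gen_x : A;
  gen_y : A;
  gen_g : gT -> A;
  scal_central : forall c a, GRing.comm (scal c) a;
  gen_ind : forall Q : A -> Prop,
    (forall c, Q (scal c)) -> Q gen_x -> Q gen_y -> (forall h, Q (gen_g h)) ->
    (forall a b, Q a -> Q b -> Q (a + b)) ->
    (forall a b, Q a -> Q b -> Q (a * b)) ->
    forall a, Q a;
  gen_g1 : gen_g 1%g = 1;
  gen_gM : forall g h, gen_g (g * h)%g = gen_g g * gen_g h;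
  gen_gL : forall g, g \in Lambda D -> gen_g g = scal (xi g);
  gen_gx : forall h, gen_g h * gen_x = scal (chi1 D h) * (gen_x * gen_g h);
  gen_gy : forall h, gen_g h * gen_y = scal (chi2 D h) * (gen_y * gen_g h);
  gen_xr : gen_x ^+ r D = 1;
  gen_ys : gen_y ^+ s D = 0;
  gen_xy : gen_x * gen_y = scal (chi2 D (g1 D)) * (gen_y * gen_x)
}.

(** * Action of [y] and weight vectors in modules over the degenerate plane *)

Section DegeneratePlaneModules.
Variables (k : closedFieldType) (gT : finGroupType) (D : plane_datum k gT).
Variables (xi : character k (Lambda D)) (A : pzRingType).
Variable S : degenerate_plane xi A.
Local Notation x := (gen_x S).
Local Notation y := (gen_y S).
Local Notation gr := (gen_g S).
Local Notation "c %:A" := (scal S c) : ring_scope.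

Let scalC c a : c%:A * a = a * c%:A := scal_central S c a.

(** Each generator commutes with [y] up to an invertible scalar, and the property passes to sums and
    products. *)
Lemma gen_y_normal a : exists b, y * a = b * y.
Proof.
elim/(gen_ind (d := S)): a => [c||| h|a b [a' ya] [b' yb]|a b [a' ya] [b' yb]].
- by exists (c%:A); rewrite scalC.
- exists ((chi2 D (g1 D))^-1%:A * x).
  rewrite -mulrA gen_xy mulrA -rmorphM mulVf ?char_neq0 //.
  by rewrite rmorph1 mul1r.
- by exists y.
- exists ((chi2 D h)^-1%:A * gr h).
  rewrite -mulrA gen_gy mulrA -rmorphM mulVf ?char_neq0 //.
  by rewrite rmorph1 mul1r.
- by exists (a' + b'); rewrite mulrDr mulrDl ya yb.
- by exists (a' * b'); rewrite mulrA ya -mulrA yb mulrA.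
Qed.

(* As [y] is normal and nilpotent, its kernel is a nonzero submodule. *)
Lemma gen_y_kills (V : lmodType A) : irreducible V -> forall v : V, y *: v = 0.
Proof.
move=> [[v0 v0_neq0] irrV].
have [|ker0|kerT v] := irrV [pred v | y *: v == 0]; last 1 first.
- by apply/eqP/kerT.
- split=> [|a u v]; rewrite !inE ?scaler0 // => /eqP yu /eqP yv.
  have [b yab] := gen_y_normal a.
  by rewrite scalerDr yv addr0 scalerA yab -scalerA yu scaler0.
have ynV n (v : V) : y ^+ n *: v = 0 -> v = 0.
  elim: n v => [|n IHn] v; first by rewrite scale1r.
  by rewrite exprSr -scalerA => /IHn yv; apply/ker0; rewrite inE yv.
by case/eqP: v0_neq0; apply: (ynV (s D)); rewrite gen_ys scale0r.
Qed.

Lemma gen_gX h n : gr h ^+ n = gr (h ^+ n)%g.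
Proof.
by elim: n => [|n IHn]; rewrite ?gen_g1 // exprS expgS gen_gM IHn.
Qed.

Lemma gen_gxX h n : gr h * x ^+ n = (chi1 D h ^+ n)%:A * (x ^+ n * gr h).
Proof.
elim: n => [|n IHn]; first by rewrite expr0 rmorph1 !mul1r mulr1.
rewrite exprSr mulrA IHn -!mulrA gen_gx exprSr rmorphM -!mulrA.
by congr (_ * _); rewrite !mulrA scalC.
Qed.

Definition weight_vector (V : lmodType A) (eta : gT -> k) (v : V) :=
  v != 0 /\ forall h, gr h *: v = (eta h)%:A *: v.

(** The group acts by commuting operators killed by [X^n - 1] with [n] the group order, a polynomial
    that splits over [k]; hence they have a common eigenvector. *)
Lemma weight_vector_exists (V : lmodType A) :
    abelian [set: gT] -> irreducible V ->
  exists (eta : extension xi) (v : V), weight_vector eta v.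
Proof.
move=> /centsP abel_gT [[v0 v0_neq0] _].
have grC g h : gr g * gr h = gr h * gr g.
  by rewrite -!gen_gM (abel_gT g _ h) ?inE.
have n_gt0 : (0 < #|gT|)%N by apply/card_gt0P; exists 1%g.
have [rs Xn1] := closed_field_poly_normal ('X^#|gT| - 1 : {poly k}).
rewrite (monicP _) ?scale1r in Xn1; last exact: monicXnsubC.
(* Group elements are treated one at a time; commutativity keeps the eigenvector conditions already
   obtained. *)
have common (l : seq gT) : exists2 v : V, v != 0 &
    forall h, h \in l -> exists c, gr h *: v = c%:A *: v.
  elim: l => [|g l [v v_neq0 vP]]; first by exists v0.
  pose Q (u : V) := forall h, h \in l -> exists c, gr h *: u = c%:A *: u.
  have grn : gr g ^+ #|gT| = 1.
    rewrite gen_gX -(gen_g1 S); congr (gr _).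
    by rewrite -cardsT expg_cardG ?inE.
  have QT z u : Q u -> Q ((gr g - z%:A) *: u).
    move=> Qu h /Qu[c hu]; exists c.
    rewrite scalerA mulrBr grC -scalC -mulrBl -scalerA hu !scalerA.
    by rewrite scalC.
  have [u [Qu u_neq0] [z gu]] :=
    eigenvector_in (scal_central S) n_gt0 Xn1 grn QT vP v_neq0.
  exists u => // h; rewrite inE => /predU1P[->|]; last exact: Qu.
  by exists z.
have [v v_neq0 vP] := common (enum gT).
have [|c cP] := @choice gT k (fun h d => gr h *: v = d%:A *: v).
  by move=> h; apply: vP; rewrite mem_enum.
(* As [v] is nonzero, eigenvalues are determined by the action, so the group relations make [c] a
   character and the relations over [Lambda] make it extend [xi]. *)
have c1 : c 1%g = 1.
  apply: (scalar_inj v_neq0 (iota := scal S)).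
  by rewrite -cP gen_g1 rmorph1.
have cM : {in [set: gT] &, {morph c : g h / (g * h)%g >-> g * h}}.
  move=> g h _ _; apply: (scalar_inj v_neq0 (iota := scal S)).
  rewrite -cP gen_gM -scalerA cP scalerA -scalC -scalerA cP scalerA.
  by rewrite -rmorphM mulrC.
have cL : {in Lambda D, c =1 xi}.
  move=> g Lg; apply: (scalar_inj v_neq0 (iota := scal S)).
  by rewrite -cP gen_gL.
by exists (@Extension _ _ _ _ (Character c1 cM) cL), v.
Qed.

Lemma weight_vector_hom (V W : lmodType A) (f : {linear V -> W}) eta v :
  injective f -> weight_vector eta v -> weight_vector eta (f v).
Proof.
move=> f_inj [v_neq0 vP]; split=> [|h]; last by rewrite -!linearZ vP.
by rewrite -(raddf0 f) (inj_eq f_inj).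
Qed.

Lemma weight_vector_xX (V : lmodType A) (eta eta' : gT -> k) (v : V) n :
    (forall h, eta' h = eta h * chi1 D h ^+ n) ->
  weight_vector eta v -> weight_vector eta' (x ^+ n *: v).
Proof.
move=> eta'E [v_neq0 vP]; split=> [|h].
  apply: contraNneq v_neq0 => xv0.
  (* [x] is invertible: [v] equals [x^(nr) v], and [x^(nr)] factors as [x^((r-1)n)] times [x^n]. *)
  rewrite -[v]scale1r -(expr1n _ n) -(gen_xr S) -exprM.
  rewrite -(prednK (ltnW (r_gt1 D))) mulSn addnC exprD -scalerA xv0.
  by rewrite scaler0.
rewrite scalerA gen_gxX -!scalerA vP !scalerA eta'E.
by rewrite -!mulrA -(scalC (eta h)) !mulrA -rmorphM mulrC.
Qed.

(** An element [b] of [B] acts as [q b]. Agreement with the action of [A] is checked on generators;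
    at [y] both sides vanish by [gen_y_kills]. *)
Lemma irreducible_factors (B : pzRingType) (p : {rmorphism A -> B})
    (q : {rmorphism B -> A}) :
    (forall c, q (p c%:A) = c%:A) -> q (p x) = x -> p y = 0 ->
    (forall h, q (p (gr h)) = gr h) ->
  forall V : lmodType A, irreducible V -> factors_through p V.
Proof.
move=> qp_scal qp_x p_y qp_g V irrV.
exists (fun b v => q b *: v).
  split=> [b u v|b c v|b c v|v]; first exact: scalerDr.
  - by rewrite rmorphD scalerDl.
  - by rewrite rmorphM scalerA.
  - by rewrite rmorph1 scale1r.
elim/(gen_ind (d := S)) => [c||| h|a b Ha Hb|a b Ha Hb] v.
- by rewrite qp_scal.
- by rewrite qp_x.
- by rewrite (gen_y_kills irrV) p_y rmorph0 scale0r.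
- by rewrite qp_g.
- by rewrite !rmorphD !scalerDl Ha Hb.
- by rewrite !rmorphM -!scalerA -Ha -Hb.
Qed.

(** * Modules with coordinates in which the generators act as on [W(eta)] *)

Section Standard.
Variables (eta : extension xi) (M : lmodType A).
Variable phi : {additive M -> 'cV[k]_(r D)}.
Variable rho : {rmorphism A -> 'M[k]_(r D)}.
Hypothesis phi_bij : bijective phi.
Hypothesis phiZ : forall a w, phi (a *: w) = rho a *m phi w.
Hypothesis rho_scal : forall c, rho c%:A = c%:M.
Hypothesis rho_x : rho x = W_gen eta Bx.
Hypothesis rho_y : rho y = 0.
Hypothesis rho_g : forall h, rho (gr h) = W_gen eta (Bh h).

Let r_gt0 : (0 < r D)%N. Proof. exact: ltnW (r_gt1 D). Qed.

Lemma phi_g h w i : phi (gr h *: w) i 0 = chi1 D h ^+ i * eta h * phi w i 0.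
Proof. by rewrite phiZ rho_g mul_diag_mx !mxE. Qed.

Lemma phi_scal c w i : phi (c%:A *: w) i 0 = c * phi w i 0.
Proof. by rewrite phiZ rho_scal mul_scalar_mx mxE. Qed.

Lemma phi_prod_subC g (T : Type) (l : seq T) (P : pred T) (c : T -> k) w i :
  phi (\prod_(t <- l | P t) (gr g - (c t)%:A) *: w) i 0 =
  \prod_(t <- l | P t) (chi1 D g ^+ i * eta g - c t) * phi w i 0.
Proof.
elim: l => [|t l IHl]; first by rewrite !big_nil scale1r mul1r.
rewrite !big_cons; case: (P t) => //; rewrite -scalerA scalerBl raddfB !mxE.
by rewrite phi_g phi_scal IHl -mulrBl mulrA.
Qed.

(* [g1] separates the basis vectors, so a polynomial in [g1] projects any
   nonzero vector to a multiple of one of them, which [x] moves around. *)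
Lemma standard_cyclic (v w : M) : v != 0 -> exists a, a *: v = w.
Proof.
have [psi phiK psiK] := phi_bij.
move=> v_neq0; have /cV0Pn[j vj_neq0] : phi v != 0.
  apply: contraNneq v_neq0 => phiv0.
  by rewrite -(phiK v) phiv0 -(raddf0 phi) phiK.
pose q (i : 'I_(r D)) := chi1 D (g1 D) ^+ i * eta (g1 D).
(* A Lagrange-type product in [g1]: it kills every coordinate except the [j]-th. *)
pose e : A := \prod_(i < r D | i != j) (gr (g1 D) - (q i)%:A).
pose c := \prod_(i < r D | i != j) (q j - q i) * phi v j 0.
have phi_e : phi (e *: v) = c *: delta_mx j 0.
  apply/colP=> l; rewrite phi_prod_subC !mxE eqxx andbT.
  have [->|ne_lj] := eqVneq l j; first by rewrite mulr1.
  by rewrite (bigD1 l) //= subrr !mul0r mulr0.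
(* The eigenvalues [q i] are distinct because [chi1 (g1)] is a primitive [r]-th root of unity. *)
have c_neq0 : c != 0.
  rewrite mulf_neq0 //; apply/prodf_neq0 => i ne_ij.
  rewrite -mulrBl mulf_neq0 ?char_neq0 // subr_eq0.
  rewrite (eq_prim_root_expr (r_order D)) !modn_small //.
  by rewrite val_eqE eq_sym.
(* After [e] isolates the [j]-th basis vector, [x^(i + (r - j))] carries it to the [i]-th one,
   indices being modulo [r]. *)
exists (\sum_(i < r D) (phi w i 0 / c)%:A * x ^+ (i + (r D - j)) * e).
apply: (can_inj phiK).
rewrite scaler_suml raddf_sum /=; apply/colP=> l; rewrite summxE.
rewrite (bigD1 l) //= big1 ?addr0 => [|i ne_il];
  rewrite -!scalerA phi_scal phiZ rmorphXn rho_x phi_e -scalemxAr -colE !mxE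
    W_genX.
  rewrite addnCA subnKC ?(ltnW (ltn_ord _)) // modnDr modn_small // eqxx.
  by rewrite mulr1 divfK.
rewrite addnCA subnKC ?(ltnW (ltn_ord _)) // modnDr modn_small //.
by rewrite val_eqE eq_sym (negPf ne_il) !mulr0.
Qed.

Lemma standard_irreducible : irreducible M.
Proof.
have [psi phiK psiK] := phi_bij.
split.
  exists (psi (const_mx 1)); apply/eqP => /(congr1 phi).
  rewrite psiK raddf0 => /colP/(_ (Ordinal r_gt0))/eqP.
  by rewrite !mxE oner_eq0.
move=> U [U0 UP].
have [|/existsNP[v /not_implyP[Uv /eqP v_neq0]]] :=
  pselect (forall v, v \in U -> v = 0); first by left.
right=> w; have [a <-] := standard_cyclic w v_neq0.
by rewrite -[_ *: _]addr0; apply: UP.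
Qed.

(** The map sending the [i]-th basis vector to [x^i v] commutes with all generators and sends the
    vector of index 0 to [v], so Schur's lemma applies. *)
Lemma standard_isomorphic (V : lmodType A) (v : V) :
  irreducible V -> weight_vector eta v -> isomorphic M V.
Proof.
move=> irrV [v_neq0 vP]; have yV := gen_y_kills irrV.
pose f (w : M) : V := \sum_i (phi w i 0)%:A *: (x ^+ i *: v).
have fB : zmod_morphism f.
  move=> w w'; rewrite -sumrB; apply: eq_bigr => i _.
  by rewrite raddfB !mxE rmorphB scalerBl.
(* Compatibility with [a] need only be tested on basis vectors, that is, on the columns of
   [rho a]. *)
have f_gen a : (forall j, \sum_i (rho a i j)%:A *: (x ^+ i *: v) =
    a *: (x ^+ (j : 'I_(r D)) *: v)) -> forall w, f (a *: w) = a *: f w.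
  move=> fa w; rewrite /f scaler_sumr.
  under eq_bigr => i _ do rewrite phiZ mxE raddf_sum scaler_suml.
  rewrite exchange_big; apply: eq_bigr => j _ /=.
  rewrite [RHS]scalerA -scalC -scalerA -fa scaler_sumr.
  by apply: eq_bigr => i _; rewrite !scalerA -rmorphM mulrC.
have fD w w' : f (w + w') = f w + f w'.
  rewrite -[in RHS](addrK w' w) fB.
  by rewrite subrK.
have fZ : scalable f.
  elim/(gen_ind (d := S)) => [c||| h|a b fa fb|a b fa fb] w.
  - apply: f_gen => j; rewrite rho_scal (bigD1 j) //= mxE eqxx.
    rewrite big1 ?addr0 // => i /negPf ne_ij.
    by rewrite mxE ne_ij rmorph0 scale0r.
  - apply: f_gen => j; rewrite rho_x (bigD1 (ordS j)) //= mxE eqxx.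
    rewrite rmorph1 scale1r big1 ?addr0 => [|i /negPf ne_ij]; last first.
      by rewrite mxE ne_ij rmorph0 scale0r.
    (* [ordS] wraps around at [r - 1], which [x^r = 1] absorbs. *)
    by rewrite expr_mod ?gen_xr // scalerA -exprS.
  - rewrite yV /f big1 // => i _.
    by rewrite phiZ rho_y mul0mx mxE rmorph0 scale0r.
  - apply: f_gen => j; rewrite rho_g (bigD1 j) //= !mxE eqxx mulr1n.
    rewrite big1 ?addr0 => [|i /negPf ne_ij]; last first.
      by rewrite !mxE ne_ij rmorph0 scale0r.
    rewrite [RHS]scalerA gen_gxX -!scalerA vP !scalerA rmorphM.
    by rewrite -!mulrA -(scalC (eta h)).
  - by rewrite !scalerDl fD fa fb.
  - by rewrite -!scalerA fa fb.
have f_lin : linear f by move=> a u w; rewrite fD fZ.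
pose fL : {linear M -> V} :=
  HB.pack f (GRing.isLinear.Build A M V *:%R f f_lin).
exists fL; apply: schur => //; first exact: standard_irreducible.
have [psi phiK psiK] := phi_bij.
exists (psi (delta_mx (Ordinal r_gt0) 0)).
rewrite /= /f (bigD1 (Ordinal r_gt0)) //=.
rewrite psiK big1 ?addr0 => [|i /negPf ne_i0]; last first.
  by rewrite mxE ne_i0 rmorph0 scale0r.
by rewrite mxE eqxx rmorph1 !scale1r.
Qed.

(** The witness is the basis vector of index 0, where the factor [chi1 h ^ 0] is 1. *)
Lemma standard_weight : exists w : M, weight_vector eta w.
Proof.
have [psi phiK psiK] := phi_bij; pose i := Ordinal r_gt0.
exists (psi (delta_mx i 0)); split.
  apply/eqP => /(congr1 phi)/colP/(_ i)/eqP.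
  by rewrite raddf0 psiK !mxE !eqxx oner_eq0.
move=> h; apply: (can_inj phiK); apply/colP=> j.
rewrite phi_g phi_scal psiK !mxE andbT.
by have [->|_] := eqVneq j i; rewrite ?mulr0 // expr0 mul1r.
Qed.

(** The group acts diagonally, so any nonzero coordinate of [w] determines its weight. *)
Lemma standard_weightP (eta' : gT -> k) (w : M) : weight_vector eta' w ->
  exists i : nat, forall h, eta' h = eta h * chi1 D h ^+ i.
Proof.
have [psi phiK psiK] := phi_bij => -[w_neq0 wP].
have /cV0Pn[i wi] : phi w != 0.
  apply: contraNneq w_neq0 => w0.
  by rewrite -(phiK w) w0 -(raddf0 phi) phiK.
exists i => h; apply: (mulIf wi).
by rewrite -phi_scal -wP phi_g [_ * eta h]mulrC.
Qed.

End Standard.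
End DegeneratePlaneModules.

(** * The presented algebra [A(xi)] as a degenerate plane, and the map back from [B(xi)] *)

Section PresentedPlane.
Variables (k : fieldType) (gT : finGroupType) (D : plane_datum k gT).
Variable xi : character k (Lambda D).
Hypotheses (alpha_1 : alpha xi = 1) (beta_0 : beta xi = 0) (nu_0 : nu D = 0).

Let relA0 a b : relA xi (a - b) -> palg_pi (relA xi) a = palg_pi (relA xi) b.
Proof. by move/palg_rel/eqP; rewrite rmorphB subr_eq0 => /eqP. Qed.

Lemma algA_ind (Q : algA xi -> Prop) :
    (forall c, Q (palg_in (relA xi) c)) ->
    Q (palg_gen (relA xi) Ax) -> Q (palg_gen (relA xi) Ay) ->
    (forall h, Q (palg_gen (relA xi) (Ah h))) ->
    (forall a b, Q a -> Q b -> Q (a + b)) ->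
    (forall a b, Q a -> Q b -> Q (a * b)) ->
  forall a, Q a.
Proof. by move=> Qc Qx Qy Qg QD QM; apply: palg_ind => //; case. Qed.

Lemma algA_g1 : palg_gen (relA xi) (Ah 1%g) = 1.
Proof. by rewrite -(rmorph1 (palg_pi _)); apply/relA0/relA_1. Qed.

Lemma algA_gM g h : palg_gen (relA xi) (Ah (g * h)%g) =
  palg_gen (relA xi) (Ah g) * palg_gen (relA xi) (Ah h).
Proof. by rewrite -rmorphM; apply/relA0/relA_M. Qed.

Lemma algA_gL g : g \in Lambda D ->
  palg_gen (relA xi) (Ah g) = palg_in (relA xi) (xi g).
Proof. by move=> Lg; apply/relA0/relA_Lambda. Qed.

Lemma algA_gx h : palg_gen (relA xi) (Ah h) * palg_gen (relA xi) Ax =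
  palg_in (relA xi) (chi1 D h) *
    (palg_gen (relA xi) Ax * palg_gen (relA xi) (Ah h)).
Proof. by rewrite -!rmorphM -palg_piZ; apply/relA0/relA_hx. Qed.

Lemma algA_gy h : palg_gen (relA xi) (Ah h) * palg_gen (relA xi) Ay =
  palg_in (relA xi) (chi2 D h) *
    (palg_gen (relA xi) Ay * palg_gen (relA xi) (Ah h)).
Proof. by rewrite -!rmorphM -palg_piZ; apply/relA0/relA_hy. Qed.

Lemma algA_xr : palg_gen (relA xi) Ax ^+ r D = 1.
Proof.
rewrite -rmorphXn -(rmorph1 (palg_pi _)); apply: relA0.
by rewrite -[1]scale1r -alpha_1; apply: relA_xr.
Qed.

Lemma algA_ys : palg_gen (relA xi) Ay ^+ s D = 0.
Proof.
rewrite -rmorphXn -(rmorph0 (palg_pi _)); apply: relA0.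
by rewrite -(scale0r 1) -beta_0; apply: relA_ys.
Qed.

Lemma algA_xy : palg_gen (relA xi) Ax * palg_gen (relA xi) Ay =
  palg_in (relA xi) (chi2 D (g1 D)) *
    (palg_gen (relA xi) Ay * palg_gen (relA xi) Ax).
Proof.
rewrite -!rmorphM -palg_piZ; apply: relA0.
by have := relA_xy xi; rewrite nu_0 scale0r addr0.
Qed.

Definition algA_plane : degenerate_plane xi (algA xi) :=
  DegeneratePlane (@palg_in_central _ _ (relA xi)) algA_ind algA_g1 algA_gM
    algA_gL algA_gx algA_gy algA_xr algA_ys algA_xy.

Definition sect_gen (b : genB gT) : algA xi :=
  match b with
  | Bx => palg_gen (relA xi) Ax
  | Bh h => palg_gen (relA xi) (Ah h)
  end.

(** With [alpha xi = 1], the relations of [B(xi)] are among those of [A(xi)], so generators may be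
    sent to their namesakes. *)
Lemma sect_rel b : relB xi b -> free_eval (palg_in (relA xi)) sect_gen b = 0.
Proof.
have C := @palg_in_central k _ (relA xi).
have M := free_evalM sect_gen C; have X := free_evalX sect_gen C.
have E := (M, X, @free_evalZ, @free_eval_gen, @free_eval1).
case=> [|g h|g Lg|h|]; rewrite raddfB /= !E /=;
  apply/eqP; rewrite subr_eq0; apply/eqP.
- exact: algA_g1.
- exact: algA_gM.
- by rewrite mulr1; apply: algA_gL.
- exact: algA_gx.
- exact: algA_xr.
Qed.

Definition sect : {rmorphism algB xi -> algA xi} :=
  palg_lift (@palg_in_central k _ (relA xi)) sect_rel.

Lemma sectE b : sect (palg_gen (relB xi) b) = sect_gen b.
Proof. exact: palg_lift_gen. Qed.

Lemma sect_in c : sect (palg_in (relB xi) c) = palg_in (relA xi) c.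
Proof. exact: palg_lift_in. Qed.

End PresentedPlane.

(** * The modules [W(eta)] over [A(xi)] and their isomorphism classes *)

Section PulledBackW.
Variables (k : closedFieldType) (gT : finGroupType) (D : plane_datum k gT).
Variable xi : character k (Lambda D).
Hypotheses (alpha_1 : alpha xi = 1) (beta_0 : beta xi = 0) (nu_0 : nu D = 0).
Local Notation pi := (proj alpha_1 beta_0 nu_0).
Local Notation S := (algA_plane alpha_1 beta_0 nu_0).
Local Notation WA eta := (pullback pi (W alpha_1 eta)).

Section Coordinates.
Variable eta : extension xi.

(** The identity, named so that an additive structure towards column vectors can be attached to
    it. *)
Definition WA_coord (w : WA eta) : 'cV[k]_(r D) := w.

Lemma WA_coord_zmod : zmod_morphism WA_coord.
Proof. by []. Qed.

HB.instance Definition _ :=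
  GRing.isZmodMorphism.Build (WA eta) 'cV[k]_(r D) WA_coord WA_coord_zmod.

Lemma WA_coord_bij : bijective WA_coord.
Proof. by exists (fun w => w). Qed.

Definition WA_rep : {rmorphism algA xi -> 'M[k]_(r D)} :=
  GRing.RMorphism.clone _ _ (W_rep alpha_1 eta \o pi) _.

Lemma WA_coordZ a w : WA_coord (a *: w) = WA_rep a *m WA_coord w.
Proof. by []. Qed.

Lemma WA_rep_scal c : WA_rep (scal S c) = c%:M.
Proof. by rewrite /= proj_in; apply: palg_lift_in. Qed.

Lemma WA_rep_x : WA_rep (gen_x S) = W_gen eta Bx.
Proof. by rewrite /= projE W_repE. Qed.

Lemma WA_rep_y : WA_rep (gen_y S) = 0.
Proof. by rewrite /= projE raddf0. Qed.

Lemma WA_rep_g h : WA_rep (gen_g S h) = W_gen eta (Bh h).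
Proof. by rewrite /= projE W_repE. Qed.

Lemma WA_irreducible : irreducible (WA eta).
Proof.
exact: (standard_irreducible WA_coord_bij WA_coordZ WA_rep_scal WA_rep_x
  WA_rep_g).
Qed.

Lemma WA_isomorphic (V : lmodType (algA xi)) (v : V) :
  irreducible V -> weight_vector S eta v -> isomorphic (WA eta) V.
Proof.
exact: (standard_isomorphic WA_coord_bij WA_coordZ WA_rep_scal WA_rep_x
  WA_rep_y WA_rep_g).
Qed.

Lemma WA_weight : exists w : WA eta, weight_vector S eta w.
Proof.
exact: (standard_weight WA_coord_bij WA_coordZ WA_rep_scal WA_rep_g).
Qed.

Lemma WA_weightP (eta' : gT -> k) (w : WA eta) : weight_vector S eta' w ->
  exists i : nat, forall h, eta' h = eta h * chi1 D h ^+ i.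
Proof.
exact: (standard_weightP WA_coord_bij WA_coordZ WA_rep_scal WA_rep_g).
Qed.

End Coordinates.

Lemma chi1_int_expr (m : int) :
  exists n : nat, forall h, chi1 D h ^ m = chi1 D h ^+ n.
Proof.
case: m => m; first by exists m.
(* The integer here is [-(m + 1)], congruent modulo [r] to [(m + 1)(r - 1)], and
   [chi1 h ^ r = 1]. *)
exists (m.+1 * (r D).-1)%N => h.
apply: (mulfI (expf_neq0 m.+1 (char_neq0 (chi1 D) h))).
rewrite divff ?expf_neq0 ?char_neq0 // -exprD -mulnS.
by rewrite (prednK (ltnW (r_gt1 D))) mulnC exprM (chi1_expr alpha_1) expr1n.
Qed.

(** An isomorphism preserves weights, and those of [W(eta')] are the [eta' chi_1^i]. Conversely a
    power of [x] moves a vector of weight [eta'] in [W(eta')] to one of weight [eta], which induces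
    an isomorphism from [W(eta)]. *)
Lemma WA_isomorphicP (eta eta' : extension xi) :
  isomorphic (WA eta) (WA eta') <->
    exists m : int, forall h : gT, eta h = eta' h * chi1 D h ^ m.
Proof.
split=> [[f f_bij]|[m etam]].
  have [v vP] := WA_weight eta.
  have [i etai] := WA_weightP (weight_vector_hom (bij_inj f_bij) vP).
  by exists i.
have [n chin] := chi1_int_expr m; have [v vP] := WA_weight eta'.
apply: (WA_isomorphic (WA_irreducible eta')).
by apply: weight_vector_xX vP => h; rewrite etam chin.
Qed.

Lemma factors_through_proj (V : lmodType (algA xi)) :
  irreducible V -> factors_through pi V.
Proof.
apply: (@irreducible_factors _ _ _ _ _ S _ pi (sect alpha_1)) => [c|||h] /=.
- by rewrite proj_in sect_in.
- by rewrite projE sectE.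
- by rewrite projE.
- by rewrite projE sectE.
Qed.

End PulledBackW.

Theorem theorem3p3 (k : closedFieldType) (char_k : [pchar k] =i pred0)
    (gT : finGroupType) (abel_gT : abelian [set: gT])
    (D : plane_datum k gT) (xi : character k (Lambda D))
    (alpha_1 : alpha xi = 1) (beta_0 : beta xi = 0) (nu_0 : nu D = 0) :
  let pi : {rmorphism algA xi -> algB xi} := proj alpha_1 beta_0 nu_0 in
  let WA (eta : extension xi) : lmodType (algA xi) :=
    pullback pi (W alpha_1 eta) in
  [/\ forall V : lmodType (algA xi), irreducible V -> factors_through pi V,
      forall eta : extension xi, irreducible (WA eta),
      forall V : lmodType (algA xi), irreducible V ->
        exists eta : extension xi, isomorphic V (WA eta)
    & forall eta eta' : extension xi, isomorphic (WA eta) (WA eta') <->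
        exists m : int, forall h : gT, eta h = eta' h * chi1 D h ^ m].
Proof.
split=> [V irrV|eta|V irrV|eta eta'].
- exact: factors_through_proj.
- exact: WA_irreducible.
- have [eta [v vP]] :=
    weight_vector_exists (algA_plane alpha_1 beta_0 nu_0) abel_gT irrV.
  (* The weight vector yields a map from [W(eta)] to [V], hence the reversal. *)
  by exists eta; apply/isomorphic_sym/(WA_isomorphic irrV vP).
- exact: WA_isomorphicP.
Qed.
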